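(* Let $u$ be an unknown complex function of $t$. The birational change of variables $$X=\frac{u}{6},\qquad Y=-\frac{u'}{u},\qquad Z=-\frac{u''}{u'}+\frac{u}{3}$$ takes the Chazy III equation $$u'''=2u\,u''-3(u')^2$$ to the system $$\frac{dX}{dt}=-XY,\qquad \frac{dY}{dt}=(2X+Y-Z)Y,\qquad \frac{dZ}{dt}=Z^2+8XZ-20XY-20X^2 .$$ Moreover, eliminating $X,Z$ from this system, the function $v:=Y$ satisfies (wherever the denominator $v^2+2v'$ is nonzero) the third-order ordinary differential equation of rational type $$v'''=-3\left(v^2-v'\right)v'+\frac{3}{2}v^4-\frac{\left(v^3-2v''\right)\left(5v^3+2v''\right)}{2\left(v^2+2v'\right)} .$$
   Context: Primes denote derivatives with respect to the complex variable $t$. A scalar third-order equation for $u$ is identified with a first-order system in the variables $(u,u',u'')$. That a birational transformation ''takes'' an equation to a system means that it is a birational map from $(u,u',u'')$-space to $(X,Y,Z)$-space such that, wherever it is defined, solutions of the equation are mapped to solutions of the system, and conversely via the inverse map. *)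

(* Defs.v *)
From HB Require Import structures.
From mathcomp Require Import all_boot all_order all_algebra.
From mathcomp Require Import fraction complex mpoly.
From mathcomp Require Import boolp classical_sets reals topology normedtype derive.

Set Implicit Arguments.
Unset Strict Implicit.
Unset Printing Implicit Defensive.

Import GRing.Theory Num.Theory.
Import numFieldNormedType.Exports.

Local Open Scope ring_scope.
Local Open Scope classical_set_scope.

(* The complex numbers. Packaging [R[i]] as a numeric field lets it inherit the
   norm, the topology and the derivatives (here: complex derivatives) which
   MathComp-Analysis attaches to an arbitrary [numFieldType]. *)
Definition Cplx (R : realType) : numClosedFieldType := R[i].

Definition vec3 (T : Type) (a b c : T) : 'I_3 -> T := tnth [tuple a; b; c].

(* The function field C(x_0, x_1, x_2) of affine 3-space. *)
Notation ratfun R := {fraction {mpoly (Cplx R)[3]}}.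

Section RationalMaps.
Variable R : realType.
Local Notation C := (Cplx R).

Definition coord (i : 'I_3) : ratfun R := tofrac ('X_i : {mpoly C[3]}).

(* [f] is defined at [a] with value [y]: some representation of [f] as a
   quotient of polynomials has a denominator which does not vanish at [a]. *)
Definition ratfun_at (f : ratfun R) (a : 'I_3 -> C) (y : C) : Prop :=
  exists p q : {mpoly C[3]},
    [/\ f = tofrac p / tofrac q, q.@[a] != 0 & y = p.@[a] / q.@[a]].

Definition ratmap := 'I_3 -> ratfun R.

(* [Phi] is defined at [a] and maps it to [b]. *)
Definition ratmap_at (Phi : ratmap) (a b : 'I_3 -> C) : Prop :=
  forall i, ratfun_at (Phi i) a (b i).

(* The composite [Psi \o Phi] is defined, and is the identity, on a dense
   Zariski-open set, i.e. [Psi \o Phi] is the identity as a rational map. *)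
Definition ratmap_cancel (Phi Psi : ratmap) : Prop :=
  exists2 d : {mpoly C[3]}, d != 0 &
    forall a : 'I_3 -> C, d.@[a] != 0 ->
      exists2 b : 'I_3 -> C, ratmap_at Phi a b & ratmap_at Psi b a.

Definition birational_inverses (Phi Psi : ratmap) : Prop :=
  ratmap_cancel Phi Psi /\ ratmap_cancel Psi Phi.

End RationalMaps.

Section DifferentialEquations.
Variable R : realType.
Local Notation C := (Cplx R).

Definition thrice_derivable (u : C -> C) (t : C) : Prop :=
  forall k, (k < 3)%N -> derivable u^`(k) t 1.

(* [u] solves u''' = G(u, u', u'') on [U]. *)
Definition solves_ode3 (G : C -> C -> C -> C) (U : set C) (u : C -> C) : Prop :=
  forall t, U t ->
    thrice_derivable u t /\ u^`(3) t = G (u t) (u^`() t) (u^`(2) t).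

(* The point of (u, u', u'')-space attained at time [t]. *)
Definition jet (u : C -> C) (t : C) : 'I_3 -> C :=
  vec3 (u t) (u^`() t) (u^`(2) t).

(* [x] solves the autonomous first-order system x' = F(x) on [U]. *)
Definition solves_system (F : ('I_3 -> C) -> 'I_3 -> C)
    (U : set C) (x : C -> 'I_3 -> C) : Prop :=
  forall t, U t -> forall i,
    derivable (fun s => x s i) t 1 /\ (fun s => x s i)^`() t = F (x t) i.

(* As [U] ranges over all open sets on which the transformed curve is defined,
   this covers solutions which leave the domain of [Phi] or [Psi]: they are
   transformed on the part where they stay inside. *)
Definition birationally_takes (Phi : ratmap R)
    (G : C -> C -> C -> C) (F : ('I_3 -> C) -> 'I_3 -> C) : Prop :=
  exists Psi : ratmap R,
    [/\ birational_inverses Phi Psi,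
        forall (U : set C) (u : C -> C) (x : C -> 'I_3 -> C),
          open U -> solves_ode3 G U u ->
          (forall t, U t -> ratmap_at Phi (jet u t) (x t)) ->
          solves_system F U x
      & forall (U : set C) (x w : C -> 'I_3 -> C),
          open U -> solves_system F U x ->
          (forall t, U t -> ratmap_at Psi (x t) (w t)) ->
          exists2 u : C -> C, solves_ode3 G U u &
            forall t, U t -> w t = jet u t].

Definition chazyIII (u u1 u2 : C) : C := 2 * u * u2 - 3 * u1 ^+ 2.

Definition chazyIII_change : ratmap R :=
  let u := coord R 0 in
  let u1 := coord R 1 in
  let u2 := coord R 2 in
  vec3 (u / 6) (- (u1 / u)) (- (u2 / u1) + u / 3).

Definition chazyIII_system (p : 'I_3 -> C) : 'I_3 -> C :=
  let X := p 0 in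
  let Y := p 1 in
  let Z := p 2 in
  vec3 (- (X * Y))
       ((2 * X + Y - Z) * Y)
       (Z ^+ 2 + 8 * X * Z - 20 * X * Y - 20 * X ^+ 2).

End DifferentialEquations.

(* Main.v *)
Require Import Defs.
From HB Require Import structures.
From mathcomp Require Import all_boot all_order all_algebra.
From mathcomp Require Import fraction complex mpoly.
From mathcomp Require Import boolp classical_sets reals topology normedtype derive.
From mathcomp Require Import ring.

Set Implicit Arguments.
Unset Strict Implicit.
Unset Printing Implicit Defensive.

Import GRing.Theory Num.Theory.
Import numFieldNormedType.Exports.

Local Open Scope ring_scope.
Local Open Scope classical_set_scope.

(** Solving the change of variables for the jet of [u] gives the polynomial map
      u = 6 X,   u' = - 6 X Y,   u'' = - 6 X Y (2 X - Z),
    which is the inverse [chazyIII_unchange]; the two maps cancel each other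
    off the hypersurface where the product of the first two coordinates
    vanishes.

    The differential part is the chain rule, once the abstract relation
    [ratmap_at] is turned into explicit formulas. The delicate point is that
    [ratfun_at] allows every representation of a rational function as a
    quotient, so that the domain of the change of variables has to be shown to
    be no larger than expected: [u] and [u'] are nonzero wherever it is defined
    ([ratfun_at_pole], [ratmap_at_change]). The transformed curve then equals
    the explicit one on an open set, and so has the same derivatives there. In
    the other direction the derivatives of [6 X] along the system are exactly
    the two other components of the inverse map, and the third one gives the
    Chazy equation ([system_to_chazyIII]).

    For the elimination put A = 2 X - Z. The system yields
      v' = v (v + A),   A' = 18 X v + 12 X A - A^2,
    so that D = v^2 + 2 v' is v (3 v + 2 A), and
      v'' = 2 v^3 + 3 v^2 A + 6 X D.
    Where D is nonzero, v' and v'' thus determine A and X, and the equation for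
    v''' is an identity between rational functions of v, A and X whose only
    denominator is D ([chazyIII_system_eliminate]). *)

(** * Points of affine 3-space *)

Lemma forall_I3 (P : 'I_3 -> Prop) : P 0 -> P 1 -> P 2 -> forall i, P i.
Proof.
move=> P0 P1 P2 [[|[|[|//]]] i3].
- by rewrite (_ : Ordinal i3 = 0); last exact: val_inj.
- by rewrite (_ : Ordinal i3 = 1); last exact: val_inj.
- by rewrite (_ : Ordinal i3 = 2); last exact: val_inj.
Qed.

Lemma vec3E (T : Type) (x y z : T) :
  (vec3 x y z 0 = x) * (vec3 x y z 1 = y) * (vec3 x y z 2 = z).
Proof. by []. Qed.

Lemma vec3_ext (T : Type) (b : 'I_3 -> T) (x y z : T) :
  b 0 = x -> b 1 = y -> b 2 = z -> b = vec3 x y z.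
Proof. by move=> bx by_ bz; apply/funext; exact: forall_I3. Qed.

(** * Values and poles of rational functions *)

Section RationalFunctions.
Variable R : realType.
Local Notation C := (Cplx R).
Implicit Types (N D p q : {mpoly C[3]}) (a b : 'I_3 -> C) (y : C).

Lemma ratfun_at_frac N D a : D.@[a] != 0 ->
  ratfun_at (tofrac N / tofrac D) a (N.@[a] / D.@[a]).
Proof. by move=> Da0; exists N, D. Qed.

(** Two representations of the same rational function satisfy the
    cross-multiplied identity as polynomials, which unlike the quotients can be
    evaluated anywhere. *)
Lemma ratfun_at_cross N D a y :
  D != 0 -> ratfun_at (tofrac N / tofrac D) a y ->
  exists p q, [/\ q.@[a] != 0, y = p.@[a] / q.@[a] & p * D = N * q].
Proof.
move=> D0 [p [q [eqf qa0 ->]]]; exists p, q; split=> //.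
have q0 : q != 0 by apply: contraNneq qa0 => ->; rewrite meval0.
apply/eqP; rewrite -tofrac_eq !tofracM; apply/eqP.
by move/eqP: eqf; rewrite eqr_div ?tofrac_eq0// => /eqP.
Qed.

Lemma ratfun_at_uniq N D a y : D.@[a] != 0 ->
  ratfun_at (tofrac N / tofrac D) a y -> y = N.@[a] / D.@[a].
Proof.
move=> Da0; have D0 : D != 0 by apply: contraNneq Da0 => ->; rewrite meval0.
case/ratfun_at_cross=> // p [q [qa0 -> pD]].
by apply/eqP; rewrite eqr_div// -!mevalM pD.
Qed.

(** Restriction to the hyperplane where the [i]-th coordinate vanishes, as a
    ring endomorphism: its values lie in an integral domain, which makes
    zero-product arguments possible on the hyperplane. *)
Definition restrict0 (i : 'I_3) p : {mpoly C[3]} :=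
  p \mPo [tuple if j == i then 0 else 'X_j | j < 3].

Lemma restrict0_meval i p a : a i = 0 -> (restrict0 i p).@[a] = p.@[a].
Proof.
move=> ai0; rewrite comp_mpoly_meval; apply: meval_eq => j.
rewrite tnth_mktuple; case: eqP => [->|_]; first by rewrite meval0.
exact: mevalXU.
Qed.

Lemma restrict0X i : restrict0 i 'X_i = 0.
Proof. by rewrite /restrict0 /comp_mpoly mmapX mmap1U tnth_mktuple eqxx. Qed.

Lemma restrict0M i p q : restrict0 i (p * q) = restrict0 i p * restrict0 i q.
Proof. exact: rmorphM. Qed.

(** If [p / q] represents [N / ('X_i * D)] then [p * 'X_i * D = N * q]. On the
    hyperplane ['X_i = 0] the left side vanishes identically, while [N] does
    not because of the point [b]; hence [q] vanishes on the whole hyperplane,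
    even where [N] does, and no representation is defined there. *)
Lemma ratfun_at_pole i N D a b y :
  D != 0 -> b i = 0 -> N.@[b] != 0 ->
  ratfun_at (tofrac N / tofrac ('X_i * D)) a y -> a i != 0.
Proof.
move=> D0 bi0 Nb0; have XD0 : 'X_i * D != 0.
  rewrite mulf_neq0//; apply/negP => /eqP /(congr1 (meval (fun=> 1))).
  by rewrite mevalXU meval0 => /eqP; rewrite oner_eq0.
case/(ratfun_at_cross XD0) => p [q [qa0 _ pD]].
apply: contraNneq qa0 => ai0.
have: restrict0 i N * restrict0 i q == 0.
  rewrite -restrict0M -pD !restrict0M restrict0X.
  by move: (restrict0 i p) (restrict0 i D) => r s; rewrite mul0r mulr0.
rewrite mulf_eq0 => /orP[] /eqP r0.
  by move: Nb0; rewrite -(restrict0_meval N bi0) r0 meval0 eqxx.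
by rewrite -(restrict0_meval q ai0) r0 meval0.
Qed.

End RationalFunctions.

(** The common denominator of the third component of the change of variables.
    It serves both for the rational function itself and for its values. *)
Lemma change2_frac (F : fieldType) (u u1 u2 : F) :
  u1 != 0 -> 3 != 0 :> F ->
  - (u2 / u1) + u / 3 = (u * u1 - 3 * u2) / (u1 * 3).
Proof. by move=> n1 n3; field; rewrite n3. Qed.

(** * The change of variables and its inverse *)

Section ChangeOfVariables.
Variable R : realType.
Local Notation C := (Cplx R).
Implicit Types (a b : 'I_3 -> C).

Definition chazyIII_point a : 'I_3 -> C :=
  vec3 (a 0 / 6) (- (a 1 / a 0)) (- (a 2 / a 1) + a 0 / 3).

Definition chazyIII_unpoint a : 'I_3 -> C :=
  vec3 (6 * a 0) (- (6 * a 0 * a 1)) (- (6 * a 0 * a 1 * (2 * a 0 - a 2))).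

Definition chazyIII_unchange : ratmap R :=
  let X := Defs.coord R 0 in
  let Y := Defs.coord R 1 in
  let Z := Defs.coord R 2 in
  vec3 (6 * X) (- (6 * X * Y)) (- (6 * X * Y * (2 * X - Z))).

Lemma tofrac_nat_neq0 n : n.+1%:R != 0 :> ratfun R.
Proof.
by rewrite -(rmorph_nat (@tofrac _)) tofrac_eq0 -mpolyC_nat mpolyC_eq0 pnatr_eq0.
Qed.

Lemma coord_neq0 i : Defs.coord R i != 0.
Proof.
rewrite /Defs.coord tofrac_eq0; apply/eqP => /(congr1 (meval (fun=> 1))).
by rewrite mevalXU meval0 => /eqP; rewrite oner_eq0.
Qed.

Lemma change0E :
  chazyIII_change R 0 = tofrac 'X_0 / tofrac 6.
Proof. by rewrite /chazyIII_change /= rmorph_nat. Qed.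

Lemma change1E :
  chazyIII_change R 1 = tofrac (- 'X_1) / tofrac ('X_0 * 1).
Proof. by rewrite mulr1 tofracN mulNr. Qed.

Lemma change2E :
  chazyIII_change R 2 = tofrac ('X_0 * 'X_1 - 3 * 'X_2) / tofrac ('X_1 * 3).
Proof.
have n1 := coord_neq0 1; have n3 := tofrac_nat_neq0 2.
rewrite tofracB !tofracM !(rmorph_nat (@tofrac _)).
rewrite -!/(Defs.coord R _) /chazyIII_change.
change (- (Defs.coord R 2 / Defs.coord R 1) + Defs.coord R 0 / 3 =
  (Defs.coord R 0 * Defs.coord R 1 - 3 * Defs.coord R 2)
  / (Defs.coord R 1 * 3)).
exact: change2_frac n1 n3.
Qed.

Lemma unchange0E : chazyIII_unchange 0 = tofrac (6 * 'X_0) / tofrac 1.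
Proof. by rewrite tofrac1 divr1 tofracM rmorph_nat. Qed.

Lemma unchange1E :
  chazyIII_unchange 1 = tofrac (- (6 * 'X_0 * 'X_1)) / tofrac 1.
Proof. by rewrite tofrac1 divr1 tofracN !tofracM rmorph_nat. Qed.

Lemma unchange2E : chazyIII_unchange 2 =
  tofrac (- (6 * 'X_0 * 'X_1 * (2 * 'X_0 - 'X_2))) / tofrac 1.
Proof.
by rewrite tofrac1 divr1 tofracN !tofracM tofracB tofracM !rmorph_nat.
Qed.

Lemma Cnat_neq0 n : n.+1%:R != 0 :> C.
Proof. by rewrite pnatr_eq0. Qed.

Let mevalR a := (mevalM, mevalB a, mevalN a, mevalXU a, meval1 a,
                 rmorph_nat (meval a)).

(** The exact domain of the change of variables. The points [(0, 1, 0)] and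
    [(0, 0, 1)] witness that the numerators of the second and third components
    do not vanish identically on the polar planes. *)
Lemma ratmap_at_change a b : ratmap_at (chazyIII_change R) a b <->
  [/\ a 0 != 0, a 1 != 0 & b = chazyIII_point a].
Proof.
have n3 : 3 != 0 :> C := Cnat_neq0 2; have n6 : 6 != 0 :> C := Cnat_neq0 5.
have v0 : (6 : {mpoly C[3]}).@[a] != 0 by rewrite !mevalR.
have v1 : a 0 != 0 -> ('X_0 * 1 : {mpoly C[3]}).@[a] != 0.
  by rewrite !mevalR mulr1.
have v2 : a 1 != 0 -> ('X_1 * 3 : {mpoly C[3]}).@[a] != 0.
  by move=> a1; rewrite !mevalR mulf_neq0.
split=> [H|[a0 a1 ->]].
- have := H 0; rewrite change0E => /(ratfun_at_uniq v0) b0.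
  have := H 1; rewrite change1E => h1.
  have a0 : a 0 != 0.
    apply: (ratfun_at_pole (b := vec3 0 1 0) _ _ _ h1) => //.
      by rewrite oner_neq0.
    by rewrite !mevalR oppr_eq0 oner_neq0.
  have := H 2; rewrite change2E => h2.
  have a1 : a 1 != 0.
    apply: (ratfun_at_pole (b := vec3 0 0 1) _ _ _ h2) => //.
      by rewrite -mpolyC_nat mpolyC_eq0.
    by rewrite !mevalR mul0r sub0r mulr1 oppr_eq0.
  split=> //; apply: vec3_ext.
  + by rewrite b0 !mevalR.
  + by rewrite (ratfun_at_uniq (v1 a0) h1) !mevalR mulr1 mulNr.
  + by rewrite (ratfun_at_uniq (v2 a1) h2) !mevalR (change2_frac _ _ a1 n3).
- apply: forall_I3.
  + by have := ratfun_at_frac 'X_0 v0; rewrite -change0E !mevalR.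
  + have := ratfun_at_frac (- 'X_1) (v1 a0).
    by rewrite -change1E !mevalR mulr1 mulNr.
  + have := ratfun_at_frac ('X_0 * 'X_1 - 3 * 'X_2) (v2 a1).
    by rewrite -change2E !mevalR -(change2_frac _ _ a1 n3).
Qed.

Lemma ratmap_at_unchange a b :
  ratmap_at chazyIII_unchange a b <-> b = chazyIII_unpoint a.
Proof.
have v : (1 : {mpoly C[3]}).@[a] != 0 by rewrite meval1 oner_neq0.
split=> [H|->].
- apply: vec3_ext.
  + have := H 0; rewrite unchange0E => /(ratfun_at_uniq v) ->.
    by rewrite !mevalR divr1.
  + have := H 1; rewrite unchange1E => /(ratfun_at_uniq v) ->.
    by rewrite !mevalR divr1.
  + have := H 2; rewrite unchange2E => /(ratfun_at_uniq v) ->.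
    by rewrite !mevalR divr1.
- apply: forall_I3.
  + by have := ratfun_at_frac (6 * 'X_0) v; rewrite -unchange0E !mevalR divr1.
  + have := ratfun_at_frac (- (6 * 'X_0 * 'X_1)) v.
    by rewrite -unchange1E !mevalR divr1.
  + have := ratfun_at_frac (- (6 * 'X_0 * 'X_1 * (2 * 'X_0 - 'X_2))) v.
    by rewrite -unchange2E !mevalR divr1.
Qed.

Lemma chazyIII_unpointK a : a 0 != 0 -> a 1 != 0 ->
  chazyIII_point (chazyIII_unpoint a) = a.
Proof.
move=> a0 a1; apply/funext; apply: forall_I3.
- by rewrite /chazyIII_point !vec3E /chazyIII_unpoint !vec3E; field.
- by rewrite /chazyIII_point !vec3E /chazyIII_unpoint !vec3E; field.
- rewrite /chazyIII_point !vec3E /chazyIII_unpoint !vec3E; field.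
  by rewrite a1 a0.
Qed.

Lemma chazyIII_pointK a : a 0 != 0 -> a 1 != 0 ->
  chazyIII_unpoint (chazyIII_point a) = a.
Proof.
move=> a0 a1; apply/funext; apply: forall_I3.
- by rewrite /chazyIII_unpoint !vec3E /chazyIII_point !vec3E; field.
- by rewrite /chazyIII_unpoint !vec3E /chazyIII_point !vec3E; field.
- by rewrite /chazyIII_unpoint !vec3E /chazyIII_point !vec3E; field; rewrite a1 a0.
Qed.

Lemma chazyIII_change_birational :
  birational_inverses (chazyIII_change R) chazyIII_unchange.
Proof.
have d0 : 'X_0 * 'X_1 != 0 :> {mpoly C[3]}.
  apply/eqP => /(congr1 (meval (fun=> 1))).
  by rewrite mevalM !mevalXU meval0 mulr1 => /eqP; rewrite oner_eq0.
split; exists ('X_0 * 'X_1) => // a; rewrite mevalM !mevalXU mulf_eq0 negb_or.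
- case/andP=> a0 a1; exists (chazyIII_point a).
    exact/ratmap_at_change.
  by apply/ratmap_at_unchange; rewrite chazyIII_pointK.
- case/andP=> a0 a1; exists (chazyIII_unpoint a).
    exact/ratmap_at_unchange.
  have n6 : 6 != 0 :> C := Cnat_neq0 5.
  apply/ratmap_at_change; split; last by rewrite chazyIII_unpointK.
    by rewrite /chazyIII_unpoint vec3E mulf_neq0.
  by rewrite /chazyIII_unpoint vec3E oppr_eq0 !mulf_neq0.
Qed.

End ChangeOfVariables.

(** * Derivatives of functions of one complex variable *)

Section Derivatives.
Variable R : realType.
Local Notation C := (Cplx R).
Implicit Types (f g u : C -> C) (t df dg : C) (U : set C).

Lemma is_derive_val f t df :
  is_derive t 1 f df <-> derivable f t 1 /\ f^`() t = df.
Proof. by split=> [[fd <-]|[fd <-]]; [rewrite derive1E|rewrite derive1E; split]. Qed.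

(** The rules of differentiation for functions given pointwise, so that a proof
    term built from them states the derivative of an explicit formula. *)
Lemma is_deriveDf f g t df dg : is_derive t 1 f df -> is_derive t 1 g dg ->
  is_derive t 1 (fun s => f s + g s) (df + dg).
Proof. exact: is_deriveD. Qed.

Lemma is_deriveNf f t df : is_derive t 1 f df ->
  is_derive t 1 (fun s => - f s) (- df).
Proof. exact: is_deriveN. Qed.

Lemma is_deriveMf f g t df dg : is_derive t 1 f df -> is_derive t 1 g dg ->
  is_derive t 1 (fun s => f s * g s) (f t * dg + g t * df).
Proof. exact: is_deriveM. Qed.

Lemma is_deriveCf (c : C) f t df : is_derive t 1 f df ->
  is_derive t 1 (fun s => c * f s) (c * df).
Proof. exact: is_deriveZ. Qed.

Lemma is_deriveVf f t df : f t != 0 -> is_derive t 1 f df ->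
  is_derive t 1 (fun s => (f s)^-1) (- (df / f t ^+ 2)).
Proof.
move=> ft0 [fd <-]; split; first exact: derivableV.
by rewrite deriveV// /GRing.scale /= mulNr mulrC.
Qed.

Lemma is_derive_on U f g t df : open U -> U t -> (forall s, U s -> f s = g s) ->
  is_derive t 1 g df -> is_derive t 1 f df.
Proof.
move=> oU Ut fg; apply: near_eq_is_derive.
by apply: filterS (open_nbhs_nbhs (conj oU Ut)) => s /fg ->.
Qed.

(** The derivative [u^`(k.+1)] is taken of a function which agrees with an
    explicit formula on [U] only; as [U] is open, both have the same derivative
    at its points, and the formulas can be differentiated one after another. *)
Lemma derive_tower U u u1 u2 u3 : open U ->
  (forall t, U t -> is_derive t 1 u (u1 t)) ->
  (forall t, U t -> is_derive t 1 u1 (u2 t)) ->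
  (forall t, U t -> is_derive t 1 u2 (u3 t)) ->
  forall t, U t -> [/\ thrice_derivable u t,
    u^`() t = u1 t, u^`(2) t = u2 t & u^`(3) t = u3 t].
Proof.
move=> oU d1 d2 d3.
have e1 s : U s -> u^`() s = u1 s by move=> /d1/is_derive_val[].
have D2 s (Us : U s) : is_derive s 1 u^`() (u2 s).
  exact: is_derive_on oU Us e1 (d2 _ Us).
have e2 s : U s -> u^`(2) s = u2 s by move=> /D2/is_derive_val[].
have D3 s (Us : U s) : is_derive s 1 u^`(2) (u3 s).
  exact: is_derive_on oU Us e2 (d3 _ Us).
move=> t Ut; split; [|exact: e1|exact: e2|by have /is_derive_val[] := D3 _ Ut].
case=> [_|[_|[_|k]]].
- exact: (@ex_derive _ _ _ _ _ _ _ (d1 _ Ut)).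
- exact: (@ex_derive _ _ _ _ _ _ _ (D2 _ Ut)).
- exact: (@ex_derive _ _ _ _ _ _ _ (D3 _ Ut)).
- by move=> k3; exfalso; move: k3; rewrite !ltnS ltn0.
Qed.

End Derivatives.

(** * The Chazy equation and the first-order system *)

Section Chazy.
Variable R : realType.
Local Notation C := (Cplx R).
Implicit Types (U : set C) (X Y Z : C -> C).

Lemma solves_system_derive U (x : C -> 'I_3 -> C) :
  solves_system (@chazyIII_system R) U x <->
  forall t, U t ->
    [/\ is_derive t 1 (x ^~ 0) (- (x t 0 * x t 1)),
        is_derive t 1 (x ^~ 1) ((2 * x t 0 + x t 1 - x t 2) * x t 1)
      & is_derive t 1 (x ^~ 2) (x t 2 ^+ 2 + 8 * x t 0 * x t 2
                                - 20 * x t 0 * x t 1 - 20 * x t 0 ^+ 2)].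
Proof.
split=> H t Ut.
  by split; apply/is_derive_val; [have := H t Ut 0|have := H t Ut 1|have := H t Ut 2].
by apply: forall_I3; have [h0 h1 h2] := H t Ut; apply/is_derive_val.
Qed.

Lemma solves_ode3_derive U G (u : C -> C) t : solves_ode3 G U u -> U t ->
  [/\ is_derive t 1 u (u^`() t), is_derive t 1 u^`() (u^`(2) t)
    & is_derive t 1 u^`(2) (G (u t) (u^`() t) (u^`(2) t))].
Proof.
move=> H Ut; have [du e3] := H t Ut.
split; apply/is_derive_val; split=> //.
- exact: (du 0%N).
- exact: (du 1%N).
- exact: (du 2%N).
Qed.

(** The curve is only assumed to be a value of the rational map at each time;
    [ratmap_at_change] makes it an explicit quotient on [U] and provides the
    nonvanishing of [u] and [u'] that differentiating it requires. *)
Lemma chazyIII_to_system U (u : C -> C) (x : C -> 'I_3 -> C) :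
  open U -> solves_ode3 (@chazyIII R) U u ->
  (forall t, U t -> ratmap_at (chazyIII_change R) (jet u t) (x t)) ->
  solves_system (@chazyIII_system R) U x.
Proof.
move=> oU Hu Hx; apply/solves_system_derive => t Ut.
have xE s : U s -> x s = chazyIII_point (jet u s).
  by move=> /Hx/ratmap_at_change[].
have [u0 u10] : u t != 0 /\ u^`() t != 0.
  by have /ratmap_at_change[] := Hx t Ut.
have [d0 d1 d2] := solves_ode3_derive Hu Ut.
rewrite (xE t Ut) /chazyIII_point /jet !vec3E.
split.
- apply: (is_derive_on (g := fun s => 6^-1 * u s) oU Ut) => [s Us|].
    by rewrite xE// mulrC.
  by apply: is_derive_eq (is_deriveCf _ d0) _; field.
- apply: (is_derive_on (g := fun s => - (derive1 u s * (u s)^-1)) oU Ut) => [s Us|].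
    by rewrite xE.
  apply: is_derive_eq (is_deriveNf (is_deriveMf d1 (is_deriveVf u0 d0))) _.
  by field; rewrite ?u10 u0.
- apply: (is_derive_on (g := fun s => - (derive1n 2 u s * (derive1 u s)^-1) + 3^-1 * u s)
    oU Ut) => [s Us|].
    by rewrite xE// [3^-1 * _]mulrC.
  apply: is_derive_eq (is_deriveDf (is_deriveNf (is_deriveMf d2
    (is_deriveVf u10 d1))) (is_deriveCf _ d0)) _.
  by rewrite /chazyIII; field; rewrite u10 ?u0.
Qed.

(** No division occurs: the components of the inverse map are polynomials in
    [X], [Y], [Z], each the derivative of the preceding one along the system,
    so that zeros of [X] and [Y] need no separate treatment. *)
Lemma system_to_chazyIII U (x w : C -> 'I_3 -> C) :
  open U -> solves_system (@chazyIII_system R) U x ->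
  (forall t, U t -> ratmap_at (chazyIII_unchange R) (x t) (w t)) ->
  exists2 u : C -> C, solves_ode3 (@chazyIII R) U u &
    forall t, U t -> w t = jet u t.
Proof.
move=> oU /solves_system_derive Hx Hw.
have wE t : U t -> w t = chazyIII_unpoint (x t) by move=> /Hw/ratmap_at_unchange.
pose u t := 6 * x t 0.
pose u1 t := - (6 * x t 0 * x t 1).
pose u2 t := - (6 * x t 0 * x t 1 * (2 * x t 0 - x t 2)).
have d0 t : U t -> is_derive t 1 u (u1 t).
  move=> /Hx[dX dY dZ]; apply: is_derive_eq (is_deriveCf _ dX) _.
  by rewrite /u1; ring.
have d1 t : U t -> is_derive t 1 u1 (u2 t).
  move=> /Hx[dX dY dZ].
  apply: is_derive_eq (is_deriveNf (is_deriveMf (is_deriveCf 6 dX) dY)) _.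
  by rewrite /u2; ring.
have d2 t : U t -> is_derive t 1 u2 (chazyIII (u t) (u1 t) (u2 t)).
  move=> /Hx[dX dY dZ].
  apply: is_derive_eq (is_deriveNf (is_deriveMf (is_deriveMf (is_deriveCf 6 dX)
    dY) (is_deriveDf (is_deriveCf 2 dX) (is_deriveNf dZ)))) _.
  by rewrite /chazyIII /u /u1 /u2; ring.
have T := derive_tower oU d0 d1 d2.
exists u => t Ut; have [du e1 e2 e3] := T t Ut.
  by split; rewrite // e1 e2 e3.
by rewrite wE// /jet e1 e2.
Qed.

(** In terms of [A = 2 X - Z] the successive derivatives of [v] are polynomials
    in [v], [A] and [X]. The equation for the third one is an identity
    between them, multiplied by [v^2 + 2 v' = v (3 v + 2 A)]. *)
Lemma chazyIII_system_eliminate U X v Z t :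
  open U ->
  solves_system (@chazyIII_system R) U (fun t => vec3 (X t) (v t) (Z t)) ->
  U t ->
  thrice_derivable v t /\
  let v0 : C := v t in let v1 : C := v^`() t in let v2 : C := v^`(2) t in
  (v0 ^+ 2 + 2 * v1 != 0 ->
   v^`(3) t =
     - 3 * (v0 ^+ 2 - v1) * v1 + 3 / 2 * v0 ^+ 4
     - (v0 ^+ 3 - 2 * v2) * (5 * v0 ^+ 3 + 2 * v2) / (2 * (v0 ^+ 2 + 2 * v1))).
Proof.
move=> oU /solves_system_derive H Ut.
have {}H s : U s -> [/\ is_derive s 1 X (- (X s * v s)),
    is_derive s 1 v ((2 * X s + v s - Z s) * v s)
  & is_derive s 1 Z (Z s ^+ 2 + 8 * X s * Z s - 20 * X s * v s - 20 * X s ^+ 2)].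
  by move=> /H.
pose A s := 2 * X s - Z s.
pose A1 s := 18 * X s * v s + 12 * X s * A s - A s ^+ 2.
have dA s : U s -> is_derive s 1 A (A1 s).
  move=> /H[dX _ dZ].
  apply: is_derive_eq (is_deriveDf (is_deriveCf 2 dX) (is_deriveNf dZ)) _.
  by rewrite /A1 /A; ring.
pose v1 s := v s * (v s + A s).
have d0 s : U s -> is_derive s 1 v (v1 s).
  by move=> /H[_ dv _]; apply: is_derive_eq dv _; rewrite /v1 /A; ring.
pose v2 s := v s * (2 * (v s * v s) + 3 * (v s * A s)
                    + 6 * (X s * (3 * v s + 2 * A s))).
have d1 s : U s -> is_derive s 1 v1 (v2 s).
  move=> Us; have := is_deriveMf (d0 _ Us) (is_deriveDf (d0 _ Us) (dA _ Us)).
  by move=> dv1; apply: is_derive_eq dv1 _; rewrite /v2 /v1 /A1; ring.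
pose B s := 3 * v s + 2 * A s.
pose v3 s :=
  v1 s * (2 * (v s * v s) + 3 * (v s * A s) + 6 * (X s * B s))
  + v s * (4 * (v s * v1 s) + 3 * (v1 s * A s + v s * A1 s)
           + 6 * (X s * (3 * v1 s + 2 * A1 s) - X s * v s * B s)).
have d2 s : U s -> is_derive s 1 v2 (v3 s).
  move=> Us; have [dX _ _] := H _ Us; have dv := d0 _ Us; have da := dA _ Us.
  have := (is_deriveMf dv (is_deriveDf (is_deriveDf
    (is_deriveCf 2 (is_deriveMf dv dv)) (is_deriveCf 3 (is_deriveMf dv da)))
    (is_deriveCf 6 (is_deriveMf dX
      (is_deriveDf (is_deriveCf 3 dv) (is_deriveCf 2 da)))))).
  by move=> dv2; apply: is_derive_eq dv2 _; rewrite /v3 /B; ring.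
have [dv e1 e2 e3] := derive_tower oU d0 d1 d2 Ut.
split=> //; cbv zeta; rewrite e1 e2 e3.
rewrite /v3 /B /v2 /v1 /A1 => D0; field.
exact: D0.
Qed.

End Chazy.

(** * The equivalence and the elimination *)

Theorem mainTheorem1 (R : realType) :
  birationally_takes (chazyIII_change R) (@chazyIII R) (@chazyIII_system R) /\
  forall (U : set (Cplx R)) (X v Z : Cplx R -> Cplx R),
    open U ->
    solves_system (@chazyIII_system R) U (fun t => vec3 (X t) (v t) (Z t)) ->
    forall t, U t ->
      thrice_derivable v t /\
      let v0 : Cplx R := v t in
      let v1 : Cplx R := v^`() t in
      let v2 : Cplx R := v^`(2) t in
      (v0 ^+ 2 + 2 * v1 != 0 ->
       v^`(3) t =
         - 3 * (v0 ^+ 2 - v1) * v1 + 3 / 2 * v0 ^+ 4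
         - (v0 ^+ 3 - 2 * v2) * (5 * v0 ^+ 3 + 2 * v2)
           / (2 * (v0 ^+ 2 + 2 * v1))).
Proof.
split; last by move=> U X v Z oU H t Ut; exact: chazyIII_system_eliminate oU H Ut.
exists (chazyIII_unchange R); split.
- exact: chazyIII_change_birational.
- by move=> U u x; exact: chazyIII_to_system.
- by move=> U x w; exact: system_to_chazyIII.
Qed.
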